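(* Let $\mathit{init}$, $\mathit{env}$, $\mathit{ctrl}$, $\mathit{plant}$, $\mathit{guarantee}$ be given, over the real-valued variables $x, v, x_c, v_c, a_n, a_s, \tau$ and the real symbolic parameters $a_s^{\min}, a_n^{\min}, a_n^{\max}, T$ (never modified by the programs), by $$\mathit{guarantee} \equiv (x \ge x_c \to v \le v_c),$$ $$\mathit{plant} \equiv \tau := 0;\ \{x' = v,\ v' = a_s,\ \tau' = 1\ \&\ v \ge 0 \land \tau \le T\},$$ $$\mathit{ctrl} \equiv \text{if } (x_c - x \ge \mathrm{msd}(T))\ \ a_s := a_n\ \ \text{else}\ \ a_s := -a_s^{\min},$$ $$\mathrm{msd}(T) \equiv \begin{cases} vT + \dfrac{a_n T^2}{2} + \dfrac{(v + a_n T)^2 - v_c^2}{2 a_s^{\min}} & \text{if } v + a_n T \ge 0,\\[2mm] -\dfrac{v^2}{2 a_n} & \text{otherwise,}\end{cases} \qquad \mathrm{msd}(0) \equiv \frac{v^2 - v_c^2}{2 a_s^{\min}},$$ $$\mathit{env} \equiv x_c := *;\ v_c := *;\ ?(v_c \ge 0 \land x_c - x \ge \mathrm{msd}(0));\ a_n := *;\ ?(-a_n^{\min} \le a_n \le a_n^{\max}),$$ $$\mathit{init} \equiv a_s^{\min} > 0 \land a_n^{\max} > 0 \land a_n^{\min} > 0 \land T > 0 \land v \ge 0 \land v_c \ge 0 \land x_c - x \ge \mathrm{msd}(0).$$ Then the differential dynamic logic formula $$\mathit{init} \to [(\mathit{env};\ \mathit{ctrl};\ \mathit{plant})^*]\,\mathit{guarantee}$$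 is valid; that is, for every state satisfying $\mathit{init}$, every state reachable from it by executing the hybrid program $(\mathit{env};\mathit{ctrl};\mathit{plant})^*$ satisfies $\mathit{guarantee}$.
   Context: Interpretation: a vehicle has position $x$ and velocity $v$; $x_c$ and $v_c$ are a critical position and critical velocity supplied by the environment; $a_n$ is the nominal requested acceleration; $a_s$ is the acceleration issued by the safety controller; $T$ is the maximal sampling time; $a_n^{\min}, a_n^{\max}, a_s^{\min}$ are positive acceleration/braking bounds. Hybrid programs and semantics. A state is a map from variables to $\mathbb{R}$. Each hybrid program $\alpha$ denotes a reachability relation $\rho(\alpha)$ on states: - $y := e$: the value of $y$ becomes the current value of the term $e$, all other variables unchanged. - $y := *$: the value of $y$ becomes an arbitrary real number, all other variables unchanged. - $?P$: relates a state to itself if $P$ holds there; otherwise the run aborts (no successor state). - $\{y' = f(y)\ \&\ Q\}$: relates $s$ to $s'$ if for some duration $d \ge 0$ there is a solution of the differential equation system on $[0,d]$ starting at $s$, ending at $s'$, such that $Q$ holds at all times in $[0,d]$; variables not in the system are unchanged. - $\alpha;\beta$: sequential composition. $\alpha \cup \beta$: nondeterministic choice (union of relations). - $\text{if }(P)\ \alpha\ \text{else}\ \beta$ abbreviates $(?P;\alpha)\cup(?\neg P;\beta)$. - $\alpha^*$: $\alpha$ repeated any finite number $n \ge 0$ of times (reflexive transitive closure). The formula $[\alpha]\phi$ holds in $s$ iff $\phi$ holds in every $s'$ with $(s,s')\in\rho(\alpha)$. A formula is valid if it holds in all states. The expressions $\mathrm{msd}(T)$ and $\mathrm{msd}(0)$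 are always evaluated with the current values of the variables occurring in them. *)

(* Defs.v *)
From Stdlib Require Import Reals List Relations.
Import ListNotations.
Open Scope R_scope.

(* The symbolic parameters ASmin, ANmin, ANmax, T are state components like the
   others, so that validity also quantifies over their values. *)
Inductive var : Set :=
  | X | V | Xc | Vc | An | As | Tau
  | ASmin | ANmin | ANmax | T.

Definition var_eq_dec (y z : var) : {y = z} + {y <> z}.
Proof. decide equality. Defined.

Definition state : Type := var -> R.

Definition upd (s : state) (y : var) (r : R) : state :=
  fun z => if var_eq_dec z y then r else s z.

(* Terms and formulas are represented by their semantics. *)
Definition term : Type := state -> R.
Definition formula : Type := state -> Prop.

Inductive hp : Type :=
  | Assign (y : var) (e : term)
  | AssignAny (y : var)
  | Test (P : formula)
  | ODE (sys : list (var * term)) (Q : formula)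
  | Seq (a b : hp)
  | Choice (a b : hp)
  | Star (a : hp).

Notation "a ;; b" := (Seq a b) (at level 90, right associativity).

Definition If (P : formula) (a b : hp) : hp :=
  Choice (Test P ;; a) (Test (fun s => ~ P s) ;; b).

(* [D_in _ _ D t] is differentiability at t relative to D: one-sided at the
   endpoints of [0, d], and no constraint when d = 0. *)
Definition solves (sys : list (var * term)) (d : R) (phi : R -> state) : Prop :=
  (forall y f, In (y, f) sys ->
     forall t, 0 <= t <= d ->
     D_in (fun u => phi u y) (fun u => f (phi u)) (fun u => 0 <= u <= d) t) /\
  (forall y, ~ In y (map fst sys) ->
     forall t, 0 <= t <= d -> phi t y = phi 0 y).

Fixpoint reach (a : hp) : relation state :=
  match a with
  | Assign y e => fun s s' => s' = upd s y (e s)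
  | AssignAny y => fun s s' => exists r : R, s' = upd s y r
  | Test P => fun s s' => s' = s /\ P s
  | ODE sys Q => fun s s' =>
      exists (d : R) (phi : R -> state),
        0 <= d /\ phi 0 = s /\ phi d = s' /\
        solves sys d phi /\
        (forall t, 0 <= t <= d -> Q (phi t))
  | Seq a b => fun s s' => exists s1, reach a s s1 /\ reach b s1 s'
  | Choice a b => fun s s' => reach a s s' \/ reach b s s'
  | Star a => clos_refl_trans state (reach a)
  end.

Definition Imp (P Q : formula) : formula := fun s => P s -> Q s.

Definition Box (a : hp) (P : formula) : formula :=
  fun s => forall s', reach a s s' -> P s'.

Definition valid (P : formula) : Prop := forall s, P s.

(* Reachable states have V >= 0 and T > 0, so the second case has An < 0, and
   ASmin > 0 by [init]: no division by zero matters. *)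
Definition msdT : term := fun s =>
  if Rle_dec 0 (s V + s An * s T)
  then s V * s T + s An * (s T) ^ 2 / 2
       + ((s V + s An * s T) ^ 2 - (s Vc) ^ 2) / (2 * s ASmin)
  else - ((s V) ^ 2 / (2 * s An)).

Definition msd0 : term := fun s =>
  ((s V) ^ 2 - (s Vc) ^ 2) / (2 * s ASmin).

Definition guarantee : formula := fun s => s X >= s Xc -> s V <= s Vc.

Definition plant : hp :=
  Assign Tau (fun _ => 0) ;;
  ODE [(X, fun s => s V); (V, fun s => s As); (Tau, fun _ => 1)]
      (fun s => s V >= 0 /\ s Tau <= s T).

Definition ctrl : hp :=
  If (fun s => s Xc - s X >= msdT s)
     (Assign As (fun s => s An))
     (Assign As (fun s => - s ASmin)).

Definition env : hp :=
  AssignAny Xc ;;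
  AssignAny Vc ;;
  Test (fun s => s Vc >= 0 /\ s Xc - s X >= msd0 s) ;;
  AssignAny An ;;
  Test (fun s => - s ANmin <= s An <= s ANmax).

Definition init : formula := fun s =>
  s ASmin > 0 /\ s ANmax > 0 /\ s ANmin > 0 /\ s T > 0 /\
  s V >= 0 /\ s Vc >= 0 /\ s Xc - s X >= msd0 s.

(* Main.v *)
(** The set [V >= 0 /\ Vc >= 0 /\ Xc - X >= msd0] (with [ASmin > 0]) is invariant
    under the loop and entails the guarantee.  Along the plant the acceleration
    [a] is constant, so by uniqueness of antiderivatives velocity and position
    are polynomials in the elapsed time.  With [b] the braking bound, invariance
    amounts to bounding the stopping cost
      [G t = v t + a t^2 / 2 + (v + a t)^2 / (2 b)]
    by [(xc - x) + vc^2 / (2 b)].  Its increments are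
      [G e - G d = (1 + a / b) * (average velocity on [d, e]) * (e - d)].
    Thus [G] is constant for [a = - b]; it decreases for [a <= - b], so the bound
    at time [0] suffices; and it increases for [a >= - b], so the bound at time
    [T], or at the stopping time [- v / a] if that comes first, suffices. *)

From Stdlib Require Import Reals List Relations Lra.
Require Import Defs.
Open Scope R_scope.

(** * Uniqueness of antiderivatives on a closed interval *)

Lemma derivable_pt_lim_D_in (p g : R -> R) (D : R -> Prop) (t : R) :
  derivable_pt_lim p t (g t) -> D_in p g D t.
Proof.
  intros Hp eps Heps.
  destruct (Hp eps Heps) as [delta Hdelta].
  exists delta; split; [apply cond_pos|].
  intros u [[_ Hne] Hdist]; simpl in *; unfold Rdist in *.
  specialize (Hdelta (u - t)).
  replace (t + (u - t)) with u in Hdelta by ring.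
  apply Hdelta; [intro; apply Hne; lra | exact Hdist].
Qed.

Lemma D_in_interior (h g : R -> R) (a b t : R) :
  a < t < b -> D_in h g (fun u => a <= u <= b) t -> derivable_pt_lim h t (g t).
Proof.
  intros Ht HD eps Heps.
  destruct (HD eps Heps) as [delta [Hdelta Hlim]].
  assert (Hpos : 0 < Rmin delta (Rmin (t - a) (b - t))).
  { repeat apply Rmin_glb_lt; lra. }
  exists (mkposreal _ Hpos); intros k Hk Hsmall; simpl in Hsmall.
  apply Rmin_Rgt_l in Hsmall; destruct Hsmall as [Hkd Hk2].
  apply Rmin_Rgt_l in Hk2; destruct Hk2 as [Hka Hkb].
  apply Rgt_lt, Rabs_def2 in Hka; apply Rgt_lt, Rabs_def2 in Hkb.
  specialize (Hlim (t + k)); simpl in Hlim; unfold Rdist in Hlim.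
  replace (t + k - t) with k in Hlim by ring.
  apply Hlim; split; [|exact Hkd].
  split; [lra|]; lra.
Qed.

Definition clamp (a b t : R) : R := Rmax a (Rmin t b).

Lemma clamp_id (a b t : R) : a <= t <= b -> clamp a b t = t.
Proof.
  intros Ht; unfold clamp; rewrite Rmin_left, Rmax_right; lra.
Qed.

Lemma clamp_range (a b t : R) : a <= b -> a <= clamp a b t <= b.
Proof.
  intros Hab; unfold clamp; split; [apply Rmax_l|].
  apply Rmax_lub; [exact Hab | apply Rmin_r].
Qed.

Lemma clamp_dist (a b t u : R) :
  a <= t <= b -> Rabs (clamp a b u - t) <= Rabs (u - t).
Proof.
  intros Ht; unfold clamp, Rmax, Rmin.
  destruct (Rle_dec u b); destruct (Rle_dec a _);
    unfold Rabs; repeat destruct Rcase_abs; lra.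
Qed.

(** Clamping moves no point farther from [t], so the [delta] found within the interval serves for
    every real [u]. *)
Lemma D_in_clamp_continuous (h g : R -> R) (a b t : R) :
  a <= t <= b -> D_in h g (fun u => a <= u <= b) t ->
  continuity_pt (fun u => h (clamp a b u)) t.
Proof.
  intros Ht HD eps Heps.
  destruct (cont_deriv _ _ _ _ HD eps Heps) as [delta [Hdelta Hlim]].
  exists delta; split; [exact Hdelta|].
  intros u [_ Hu]; simpl in *; unfold Rdist in *.
  rewrite (clamp_id a b t Ht).
  (* [Hlim] covers only points other than [t], but at an endpoint whole half-lines are clamped to
     [t]. *)
  destruct (Req_dec (clamp a b u) t) as [->|Hne].
  - unfold Rminus; rewrite Rplus_opp_r, Rabs_R0; exact Heps.
  - apply Hlim; split.
    + split; [apply clamp_range; lra | congruence].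
    + eapply Rle_lt_trans; [apply clamp_dist; exact Ht | exact Hu].
Qed.

(* [null_derivative_loc] wants two-sided continuity at the endpoints, hence the
   detour through the clamped function. *)
Lemma D_in_zero_constant (h : R -> R) (a b : R) :
  (forall t, a <= t <= b -> D_in h (fun _ => 0) (fun u => a <= u <= b) t) ->
  forall t, a <= t <= b -> h t = h a.
Proof.
  intros HD t Ht.
  set (H := fun u => h (clamp a b u)).
  assert (HH : forall u, a < u < b -> derivable_pt_lim H u 0).
  { intros u Hu; apply (D_in_interior H (fun _ => 0) a b u Hu).
    intros eps Heps.
    destruct (HD u ltac:(lra) eps Heps) as [delta [Hdelta Hlim]].
    exists delta; split; [exact Hdelta|].
    intros w Hw; unfold H; rewrite (clamp_id a b u), (clamp_id a b w).
    - apply Hlim, Hw.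
    - apply Hw.
    - lra. }
  pose (pr := fun u Hu => exist (derivable_pt_abs H u) 0 (HH u Hu)).
  assert (Hc : constant_D_eq H (fun u => a <= u <= b) (H a)).
  { apply (null_derivative_loc H a b pr).
    - intros u Hu; exact (D_in_clamp_continuous h _ a b u Hu (HD u Hu)).
    - reflexivity. }
  specialize (Hc t Ht); unfold H in Hc.
  rewrite (clamp_id a b t), (clamp_id a b a) in Hc by lra; exact Hc.
Qed.

Lemma antiderivative_unique (f p g : R -> R) (a b : R) :
  (forall t, a <= t <= b -> D_in f g (fun u => a <= u <= b) t) ->
  (forall t, derivable_pt_lim p t (g t)) ->
  forall t, a <= t <= b -> f t = f a + (p t - p a).
Proof.
  intros Hf Hp t Ht.
  assert (E : f t - p t = f a - p a); [|lra].
  apply (D_in_zero_constant (fun u => f u - p u) a b); [|exact Ht].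
  intros u Hu.
  pose proof (Dminus _ g g f p u (Hf u Hu) (derivable_pt_lim_D_in p g _ u (Hp u))) as HD.
  (* [D_in] uses the derivative function at [u] only, so unfolding exposes the single value
     [g u - g u]. *)
  unfold D_in in *; rewrite Rminus_diag in HD; exact HD.
Qed.

Lemma derivable_pt_lim_quadratic (v a t : R) :
  derivable_pt_lim (fun u => v * u + a * u ^ 2 / 2) t (v + a * t).
Proof.
  apply derivable_pt_lim_ext with (f := (mult_real_fct v id + mult_real_fct (a / 2) (fun u => u ^ 2))%F).
  - intros u; unfold plus_fct, mult_real_fct, id; field.
  - replace (v + a * t) with (v * 1 + a / 2 * (INR 2 * t ^ pred 2)) by (simpl; field).
    apply derivable_pt_lim_plus; apply derivable_pt_lim_scal.
    + apply derivable_pt_lim_id.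
    + apply derivable_pt_lim_pow.
Qed.

Lemma constant_slope (f : R -> R) (c d : R) :
  (forall t, 0 <= t <= d -> D_in f (fun _ => c) (fun u => 0 <= u <= d) t) ->
  forall t, 0 <= t <= d -> f t = f 0 + c * t.
Proof.
  intros Hf t Ht.
  rewrite (antiderivative_unique f (fun u => c * u + 0 * u ^ 2 / 2) (fun _ => c) 0 d Hf);
    [lra | | exact Ht].
  intros u; pose proof (derivable_pt_lim_quadratic c 0 u) as Hq.
  replace (c + 0 * u) with c in Hq by ring; exact Hq.
Qed.

(** * The stopping cost and its bounds *)

(** Distance covered up to time [t], plus the braking distance at rate [b] from the speed then
    reached. The first case of [msdT] is its value at [T] minus [Vc ^ 2 / (2 * ASmin)]. *)
Definition stop_cost (b v a t : R) : R :=
  v * t + a * t ^ 2 / 2 + (v + a * t) ^ 2 / (2 * b).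

Lemma stop_cost_diff (b v a d e : R) : b > 0 ->
  stop_cost b v a e - stop_cost b v a d
  = (b + a) * (((v + a * e) + (v + a * d)) * (e - d)) / (2 * b).
Proof.
  intros Hb; unfold stop_cost; field; lra.
Qed.

Lemma stop_cost_le (b v a d e : R) :
  b > 0 -> d <= e -> v + a * d >= 0 -> v + a * e >= 0 -> b + a >= 0 ->
  stop_cost b v a d <= stop_cost b v a e.
Proof.
  intros Hb Hde Hd He Hab.
  assert (0 <= stop_cost b v a e - stop_cost b v a d); [|lra].
  rewrite stop_cost_diff by exact Hb.
  apply Rmult_le_pos; [|left; apply Rinv_0_lt_compat; lra].
  repeat apply Rmult_le_pos; lra.
Qed.

Lemma stop_cost_ge (b v a d e : R) :
  b > 0 -> d <= e -> v + a * d >= 0 -> v + a * e >= 0 -> b + a <= 0 ->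
  stop_cost b v a e <= stop_cost b v a d.
Proof.
  intros Hb Hde Hd He Hab.
  assert (0 <= stop_cost b v a d - stop_cost b v a e); [|lra].
  replace (stop_cost b v a d - stop_cost b v a e)
    with (- (stop_cost b v a e - stop_cost b v a d)) by ring.
  rewrite stop_cost_diff by exact Hb.
  replace (- _) with (- (b + a) * ((v + a * e + (v + a * d)) * (e - d)) / (2 * b))
    by (field; lra).
  apply Rmult_le_pos; [|left; apply Rinv_0_lt_compat; lra].
  repeat apply Rmult_le_pos; lra.
Qed.

Lemma stop_cost_0 (b v a : R) : stop_cost b v a 0 = v ^ 2 / (2 * b).
Proof.
  unfold stop_cost; replace (v + a * 0) with v by ring; lra.
Qed.

(** The speed vanishes at [- v / a], so only the distance covered remains: the second case of
    [msdT]. *)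
Lemma stop_cost_stopping_time (b v a : R) :
  b > 0 -> a < 0 -> stop_cost b v a (- v / a) = - (v ^ 2 / (2 * a)).
Proof.
  intros Hb Ha; unfold stop_cost; field; lra.
Qed.

(** At time 0 the cost does not depend on [a], so [msd0] can be compared with any acceleration. *)
Lemma msd0_stop_cost (s : state) (a : R) : s ASmin > 0 ->
  msd0 s = stop_cost (s ASmin) (s V) a 0 - s Vc ^ 2 / (2 * s ASmin).
Proof.
  intros Hb; rewrite stop_cost_0; unfold msd0; field; lra.
Qed.

Lemma stop_cost_nominal (s : state) (d : R) :
  s ASmin > 0 -> s V >= 0 -> 0 <= d <= s T -> s V + s An * d >= 0 ->
  s Xc - s X >= msd0 s -> s Xc - s X >= msdT s ->
  stop_cost (s ASmin) (s V) (s An) d <= s Xc - s X + s Vc ^ 2 / (2 * s ASmin).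
Proof.
  intros Hb Hv Hd Hw H0 HT.
  rewrite (msd0_stop_cost s (s An) Hb) in H0.
  destruct (Rle_dec (s ASmin + s An) 0) as [Hab|Hab].
  - enough (stop_cost (s ASmin) (s V) (s An) d <= stop_cost (s ASmin) (s V) (s An) 0) by lra.
    apply stop_cost_ge; lra.
  - unfold msdT in HT; destruct Rle_dec as [HwT|HwT].
    + enough (stop_cost (s ASmin) (s V) (s An) d <= stop_cost (s ASmin) (s V) (s An) (s T)).
      { unfold stop_cost in *; lra. }
      apply stop_cost_le; lra.
    + assert (Ha : s An < 0) by nra.
      (* The second case of [msdT] has no [Vc] term, so this term of the bound is slack. *)
      assert (0 <= s Vc ^ 2 / (2 * s ASmin)).
      { apply Rmult_le_pos; [apply pow2_ge_0 | left; apply Rinv_0_lt_compat; lra]. }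
      enough (stop_cost (s ASmin) (s V) (s An) d
              <= stop_cost (s ASmin) (s V) (s An) (- s V / s An)).
      { rewrite (stop_cost_stopping_time _ _ _ Hb Ha) in *; lra. }
      assert (Hstop : s An * (- s V / s An) = - s V) by (field; lra).
      apply stop_cost_le; try lra.
      (* What is left is [d <= - V / An]: the speed is still nonnegative at [d]. *)
      nra.
Qed.

Lemma stop_cost_braking (b v d : R) :
  b > 0 -> stop_cost b v (- b) d = v ^ 2 / (2 * b).
Proof.
  intros Hb; unfold stop_cost; field; lra.
Qed.

(** * Solving the plant *)

Lemma plant_trajectory (s s' : state) : reach plant s s' ->
  exists d, 0 <= d <= s T /\ s' V >= 0 /\
    s' V = s V + s As * d /\ s' X = s X + (s V * d + s As * d ^ 2 / 2) /\
    s' Xc = s Xc /\ s' Vc = s Vc /\ s' ASmin = s ASmin.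
Proof.
  intros [s1 [-> [d [phi [Hd [H0 [<- [[Hode Hconst] HQ]]]]]]]].
  assert (Hc : forall y, ~ In y (X :: V :: Tau :: nil) ->
    forall t, 0 <= t <= d -> phi t y = s y).
  { intros y Hy t Ht; rewrite (Hconst y Hy t Ht), H0; unfold upd.
    destruct var_eq_dec as [->|_]; [destruct Hy; simpl; tauto | reflexivity]. }
  assert (EV0 : phi 0 V = s V) by (rewrite H0; reflexivity).
  assert (EX0 : phi 0 X = s X) by (rewrite H0; reflexivity).
  assert (ET0 : phi 0 Tau = 0) by (rewrite H0; reflexivity).
  assert (EV : forall t, 0 <= t <= d -> phi t V = s V + s As * t).
  { rewrite <- EV0; apply (constant_slope (fun t => phi t V)).
    intros t Ht; pose proof (Hode V _ ltac:(simpl; tauto) t Ht) as HD.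
    unfold D_in in *; rewrite (Hc As) in HD; [exact HD | simpl; intuition discriminate | exact Ht]. }
  (* The clock measures the duration, turning the domain constraint on [Tau] into [d <= T]. *)
  assert (ET : phi d Tau = d).
  { rewrite (constant_slope (fun t => phi t Tau) 1 d); [lra | | lra].
    intros t Ht; exact (Hode Tau _ ltac:(simpl; tauto) t Ht). }
  assert (EX : phi d X = s X + (s V * d + s As * d ^ 2 / 2)).
  { rewrite (antiderivative_unique (fun t => phi t X)
      (fun t => s V * t + s As * t ^ 2 / 2) (fun t => s V + s As * t) 0 d).
    - rewrite EX0; lra.
    - intros t Ht; pose proof (Hode X _ ltac:(simpl; tauto) t Ht) as HD.
      unfold D_in in *; rewrite EV in HD by exact Ht; exact HD.
    - intros t; apply derivable_pt_lim_quadratic.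
    - lra. }
  destruct (HQ d ltac:(lra)) as [HV HT].
  rewrite ET, (Hc T) in HT; [| simpl; intuition discriminate | lra].
  exists d; repeat split; try lra.
  1: apply EV; lra.
  all: apply Hc; [simpl; intuition discriminate | lra].
Qed.

(** * Invariance under the loop *)

Definition loop_inv : formula := fun s =>
  s ASmin > 0 /\ s V >= 0 /\ s Vc >= 0 /\ s Xc - s X >= msd0 s.

Lemma env_loop_inv (s s' : state) : loop_inv s -> reach env s s' -> loop_inv s'.
Proof.
  intros [Hb [Hv _]] [s1 [[xc ->] [s2 [[vc ->] [s3 [[-> [Hvc H0]] [s4 [[an ->] [-> _]]]]]]]]].
  exact (conj Hb (conj Hv (conj Hvc H0))).
Qed.

(** Moving the distance covered to the other side turns the cost bound at [d] into the [msd0] bound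
    at the final state. *)
Lemma plant_loop_inv (s s' : state) :
  loop_inv s ->
  (forall d, 0 <= d <= s T -> s V + s As * d >= 0 ->
     stop_cost (s ASmin) (s V) (s As) d <= s Xc - s X + s Vc ^ 2 / (2 * s ASmin)) ->
  reach plant s s' -> loop_inv s'.
Proof.
  intros [Hb [Hv [Hvc _]]] Hcost Hr.
  destruct (plant_trajectory s s' Hr) as [d [Hd [HV [EV [EX [EXc [EVc EA]]]]]]].
  specialize (Hcost d Hd ltac:(lra)).
  unfold loop_inv, msd0; rewrite EXc, EVc, EA, EX.
  repeat split; try assumption.
  rewrite EV; unfold stop_cost in Hcost.
  rewrite Rdiv_minus_distr; lra.
Qed.

Lemma ctrl_plant_loop_inv (s s' : state) :
  loop_inv s -> reach (ctrl ;; plant) s s' -> loop_inv s'.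
Proof.
  intros HI [s1 [Hctrl Hplant]].
  destruct HI as [Hb [Hv [Hvc H0]]].
  destruct Hctrl as [[s2 [[-> HT] ->]]|[s2 [[-> _] ->]]].
  - refine (plant_loop_inv _ s' _ _ Hplant).
    + exact (conj Hb (conj Hv (conj Hvc H0))).
    + intros d Hd Hw.
      exact (stop_cost_nominal s d Hb Hv Hd Hw H0 HT).
  - refine (plant_loop_inv _ s' _ _ Hplant).
    + exact (conj Hb (conj Hv (conj Hvc H0))).
    + intros d _ _.
      change (stop_cost (s ASmin) (s V) (- s ASmin) d
              <= s Xc - s X + s Vc ^ 2 / (2 * s ASmin)).
      rewrite stop_cost_braking by exact Hb.
      unfold msd0 in H0; rewrite Rdiv_minus_distr in H0; lra.
Qed.

(** At or past [Xc] the invariant forces [msd0 <= 0], hence [V ^ 2 <= Vc ^ 2] with both speeds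
    nonnegative. *)
Lemma loop_inv_guarantee (s : state) : loop_inv s -> guarantee s.
Proof.
  intros [Hb [Hv [Hvc H0]]] Hx.
  unfold msd0 in H0.
  assert (Hsq : (s V ^ 2 - s Vc ^ 2) / (2 * s ASmin) * (2 * s ASmin)
                = s V ^ 2 - s Vc ^ 2) by (field; lra).
  nra.
Qed.

Theorem theorem4 :
  valid (Imp init (Box (Star (env ;; ctrl ;; plant)) guarantee)).
Proof.
  intros s Hinit s' Hr.
  apply loop_inv_guarantee.
  assert (HI : loop_inv s) by (unfold init in Hinit; unfold loop_inv; tauto).
  (* With [Hinit] gone, the induction hypotheses have [loop_inv] as their only premise, which the
     transitive case can chain. *)
  clear Hinit; simpl in Hr.
  induction Hr as [s s' [s1 [Henv Hrest]] | s | s s1 s' _ IH1 _ IH2].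
  - exact (ctrl_plant_loop_inv s1 s' (env_loop_inv s s1 HI Henv) Hrest).
  - exact HI.
  - exact (IH2 (IH1 HI)).
Qed.
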